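(* Let $p$ be an odd prime, $n\geq 1$ an integer, and $q=p^{2n}$. There exists a projective plane $\Sigma$ of order $q$ and a polarity $\theta$ of $\Sigma$ that is neither orthogonal nor unitary, such that the polarity graph $G(\Sigma,\theta)$ satisfies \[ \alpha(G(\Sigma,\theta)) \geq \tfrac{1}{2} q(\sqrt{q}-1). \]
   Context: For a projective plane $\Sigma=(\mathcal{P},\mathcal{L},\mathcal{I})$ of order $q$, a polarity is a bijection $\theta$ of $\mathcal{P}\cup\mathcal{L}$ with $\theta(\mathcal{P})=\mathcal{L}$, $\theta(\mathcal{L})=\mathcal{P}$, $\theta^2=\mathrm{id}$, and $p\,\mathcal{I}\,l$ iff $l^\theta\,\mathcal{I}\,p^\theta$. A point $p$ is absolute if $p\,\mathcal{I}\,p^\theta$. The polarity is orthogonal if it has exactly $q+1$ absolute points, and unitary if it has exactly $q^{3/2}+1$ absolute points. The polarity graph $G(\Sigma,\theta)$ has vertex set $\mathcal{P}$, with distinct points $p_1,p_2$ adjacent iff $p_1\,\mathcal{I}\,p_2^\theta$. $\alpha$ denotes the independence number. *)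

(* Defs.v *)
From mathcomp Require Import all_boot.
Set Implicit Arguments. Unset Strict Implicit. Unset Printing Implicit Defensive.

Section Plane.
Variables (P L : finType) (I : P -> L -> bool).

Definition projective_plane_of_order (q : nat) : Prop :=
  [/\ 2 <= q,
      (forall x y : P, x != y -> #|[set l : L | I x l && I y l]| = 1),
      (forall l m : L, l != m -> #|[set x : P | I x l && I x m]| = 1),
      (forall l : L, #|[set x : P | I x l]| = q.+1) &
      (forall x : P, #|[set l : L | I x l]| = q.+1)].

(* A polarity: theta restricted to points is f : P -> L, restricted to lines
   is g : L -> P; theta^2 = id means g \o f = id and f \o g = id; and
   p I l  <->  l^theta I p^theta. *)
Definition polarity (f : P -> L) (g : L -> P) : Prop :=
  [/\ cancel f g, cancel g f & forall x l, I x l = I (g l) (f x)].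

Definition absolute_points (f : P -> L) : {set P} := [set x | I x (f x)].

Definition orthogonal_polarity (q : nat) (f : P -> L) : Prop :=
  #|absolute_points f| = q.+1.

(* q^{3/2} + 1 absolute points (q^{3/2} an integer, i.e. q = s^2). *)
Definition unitary_polarity (q : nat) (f : P -> L) : Prop :=
  exists s, s * s = q /\ #|absolute_points f| = s * q + 1.

Definition polarity_adj (f : P -> L) (x y : P) : bool := (x != y) && I x (f y).

Definition independent_set (f : P -> L) (S : {set P}) : bool :=
  [forall x in S, forall y in S, ~~ polarity_adj f x y].

Definition independence_number (f : P -> L) : nat :=
  \max_(S : {set P} | independent_set f S) #|S|.

End Plane.

(* Main.v *)
From mathcomp Require Import all_boot ssralg poly finalg finfield.
From mathcomp Require Import ring zify.
Require Import Defs.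
Set Implicit Arguments. Unset Strict Implicit. Unset Printing Implicit Defensive.
Import GRing.Theory.
Local Open Scope ring_scope.

(* The plane is the Hughes plane of order q = s^2, s = p^n, written over the
   field K with q elements and its involution x |-> x^s, denoted conj.  The
   Dickson nearfield multiplies g by x as g x if g is a square and as
   g (conj x) otherwise; points and lines are both the nonzero vectors of K^3
   modulo left nearfield multiplication.  With the bilinear form
   x1 y3 + x2 y2 + x3 y1, put A = <x, y> and B = <x, conj y>; then x lies on y
   iff either B = 0 and A is a square, or A = 0 and B is a nonsquare.  This is
   symmetric in x and y, so the identity is a polarity.  Its absolute points
   are the points of a Hermitian curve at which the quadratic form <x, x> is a
   square; two absolute points are never adjacent, since two orthogonal points
   of a Hermitian curve coincide.  Exactly (s^3 + s)/2 + 1 points are absolute,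
   which is neither s^2 + 1 nor s^3 + 1 and exceeds s^2 (s - 1)/2. *)

Lemma card_roots_leq (F : finIdomainType) (r : {poly F}) (A : {set F}) :
  r != 0 -> (forall x, x \in A -> root r x) -> (#|A| < size r)%N.
Proof.
move=> r0 Ar; rewrite cardE; apply: max_poly_roots => //; last exact: enum_uniq.
by apply/allP=> x; rewrite mem_enum; apply: Ar.
Qed.


(** * Double counting of joins *)

Section CountingPlane.

Variables (P L : finType) (I : P -> L -> bool) (q : nat).
Hypothesis card_P : #|P| = (q.+1 * q).+1.
Hypothesis card_line : forall l, #|[set x | I x l]| = q.+1.
Hypothesis card_pencil : forall x, #|[set l | I x l]| = q.+1.
Hypothesis join_leq1 : forall x y, x != y -> (#|[set l | I x l && I y l]| <= 1)%N.

(* Sending a point y != x to the lines joining it to x counts q(q+1) pairs,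
   which is the number of available y: every bound [join_leq1] is attained. *)
Lemma join_eq1 x y : x != y -> #|[set l | I x l && I y l]| = 1%N.
Proof.
move=> xy; pose J z := #|[set l | I x l && I z l]|.
have J1 z : z != x -> (J z <= 1 ?= iff (J z == 1))%N.
  by move=> zx; split=> //; apply: join_leq1; rewrite eq_sym.
have [_] := leqif_sum J1.
suff -> : (\sum_(z | z != x) J z = \sum_(z | z != x) 1)%N.
  by rewrite eqxx => /esym /forall_inP /(_ y); rewrite eq_sym xy => /(_ isT) /eqP.
have -> : (\sum_(z | z != x) 1 = q.+1 * q)%N.
  by rewrite sum1_card cardC1 card_P.
rewrite -(card_pencil x) -sum_nat_const.
rewrite (eq_bigr (fun z => \sum_(l | I x l && I z l) 1)%N); last first.
  by move=> z _; rewrite sum1dep_card.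
rewrite (exchange_big_dep (fun l => I x l)) /=; last by move=> z l _ /andP[].
rewrite [RHS](eq_bigl (fun l => I x l)) => [|l]; last by rewrite inE.
apply: eq_bigr => l xl.
have := card_line l; rewrite (cardsD1 x) inE xl => -[<-].
by rewrite sum1dep_card; apply: eq_card => z; rewrite !inE /= ?xl.
Qed.

End CountingPlane.

(** * The involution and the quadratic character of K *)

Section HughesPlane.

Variables (K : finFieldType) (s : nat).
Hypotheses (s_odd : odd s) (s_gt1 : (1 < s)%N) (cardK : #|K| = (s ^ 2)%N).
Hypotheses (two_neq0 : 2%:R != 0 :> K).
Hypothesis frobD : forall x y : K, (x + y) ^+ s = x ^+ s + y ^+ s.

Definition conj (x : K) : K := x ^+ s.

Lemma conjD x y : conj (x + y) = conj x + conj y.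
Proof. exact: frobD. Qed.

Lemma conjM x y : conj (x * y) = conj x * conj y.
Proof. exact: exprMn. Qed.

Lemma conjN x : conj (- x) = - conj x.
Proof. by rewrite /conj exprNn -signr_odd s_odd expr1 mulN1r. Qed.

Lemma conjB x y : conj (x - y) = conj x - conj y.
Proof. by rewrite conjD conjN. Qed.

Lemma conj0 : conj 0 = 0.
Proof. by rewrite /conj expr0n; case: s s_gt1. Qed.

Lemma conj1 : conj 1 = 1.
Proof. exact: expr1n. Qed.

Lemma conjK : involutive conj.
Proof. by move=> x; rewrite /conj -exprM mulnn -cardK expf_card. Qed.

Lemma conj_eq0 x : (conj x == 0) = (x == 0).
Proof. by rewrite -(inj_eq (inv_inj conjK) x) conj0. Qed.

(* The exponent is (s^2 - 1)/2, so this is Euler's criterion. *)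
Definition nonsquare (x : K) : bool := x ^+ (s.-1./2 * s.+1) == -1.

Lemma half_pred_s : (s.-1./2 * 2).+1 = s.
Proof. by case: s s_odd => // t /= ot; rewrite muln2 even_halfK. Qed.

Lemma one_neqN1 : (1 == -1 :> K) = false.
Proof. by rewrite -subr_eq0 opprK (negPf two_neq0). Qed.

Lemma quadratic_character x :
  x != 0 -> x ^+ (s.-1./2 * s.+1) = (-1) ^+ nonsquare x.
Proof.
move=> x0; rewrite /nonsquare; set c := x ^+ _.
have /eqP : c ^+ 2 = 1.
  (* Multiplying by [x] reduces the claim to [x ^+ #|K| = x]. *)
  apply: (mulfI x0); rewrite mulr1 /c -exprM -exprS -[RHS]expf_card cardK.
  by congr (_ ^+ _); have := half_pred_s; nia.
by rewrite sqrf_eq1 => /orP[] /eqP ->; rewrite ?one_neqN1 ?eqxx.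
Qed.

Lemma nonsquare0 : nonsquare 0 = false.
Proof.
rewrite /nonsquare expr0n.
have -> : (s.-1./2 * s.+1 == 0)%N = false by have := half_pred_s; nia.
by rewrite eq_sym oppr_eq0 oner_eq0.
Qed.

Lemma nonsquareM x y :
  x != 0 -> y != 0 -> nonsquare (x * y) = nonsquare x (+) nonsquare y.
Proof.
move=> x0 y0; have xy0 : x * y != 0 by rewrite mulf_neq0.
have := quadratic_character xy0.
rewrite exprMn !quadratic_character // -signr_addb.
by do 3![case: nonsquare] => //= /eqP; rewrite ?one_neqN1 // eq_sym one_neqN1.
Qed.

(** The exponent in [nonsquare] is a multiple of s + 1 and [x * conj x] is x^(s+1), so the quadratic
    character factors through the norm. *)
Lemma nonsquare_norm x y : x * conj x = y * conj y -> nonsquare x = nonsquare y.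
Proof.
rewrite /conj -!exprS => e.
by rewrite /nonsquare mulnC !exprM e.
Qed.

Lemma nonsquare_conj x : nonsquare (conj x) = nonsquare x.
Proof. by apply: nonsquare_norm; rewrite conjK mulrC. Qed.

(** A nonzero fixed element satisfies x^(s-1) = 1, and s - 1 divides the Euler exponent because s +
    1 is even. *)
Lemma nonsquare_fixed x : conj x = x -> nonsquare x = false.
Proof.
case: (eqVneq x 0) => [-> _|x0]; first exact: nonsquare0.
have -> : conj x = x ^+ s.-1 * x by rewrite -exprSr prednK // ltnW.
rewrite -{3}[x]mul1r => /(mulIf x0) e.
rewrite /nonsquare -(_ : (s.-1 * (s.-1./2).+1 = s.-1./2 * s.+1)%N).
  by rewrite exprM e expr1n one_neqN1.
by have := half_pred_s; nia.
Qed.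

Lemma nonsquare1 : nonsquare 1 = false.
Proof. by apply: nonsquare_fixed; rewrite conj1. Qed.

Lemma nonsquareV x : nonsquare x^-1 = nonsquare x.
Proof.
case: (eqVneq x 0) => [->|x0]; first by rewrite invr0.
have := nonsquare1; rewrite -(divff x0) nonsquareM ?invr_eq0 //.
by do 2![case: nonsquare].
Qed.

(** The fibres of x^h over 1 and -1 are root sets of X^h - c, so each has at most h elements;
    together they fill the 2h nonzero elements, so both bounds are attained. *)
Lemma card_nonsquare : (#|[set x | nonsquare x]| * 2 = s ^ 2 - 1)%N.
Proof.
set h := (s.-1./2 * s.+1)%N.
have h0 : (0 < h)%N by rewrite /h; have := half_pred_s; nia.
have hq : (h * 2 = s ^ 2 - 1)%N by rewrite /h; have := half_pred_s; nia.
have bound (c : K) (A : {set K}) : (forall x, x \in A -> x ^+ h = c) ->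
    (#|A| <= h)%N.
  move=> Ac; rewrite -ltnS -(size_XnsubC c h0); apply: card_roots_leq.
    by rewrite -size_poly_eq0 size_XnsubC.
  by move=> x /Ac xc; rewrite rootE !hornerE xc subrr.
have b1 : (#|[set x | nonsquare x]| <= h)%N.
  by apply: (bound (-1)) => x; rewrite inE => /eqP.
have b2 : (#|[set x : K | (x != 0%R) && ~~ nonsquare x]| <= h)%N.
  apply: (bound 1) => x; rewrite inE => /andP[x0 nx].
  by rewrite quadratic_character // (negPf nx).
have := cardsC [set x | nonsquare x]; rewrite cardK.
have -> : ~: [set x | nonsquare x] = 0 |: [set x | (x != 0) && ~~ nonsquare x].
  by apply/setP => x; rewrite !inE; case: eqVneq => //= ->; rewrite nonsquare0.
rewrite cardsU1 inE eqxx /=; move: b1 b2 hq; clearbody h.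
have : (0 < s ^ 2)%N by rewrite expn_gt0 ltnW.
by set u := #|_|; set v := #|_|; lia.
Qed.

(** * The fixed field and skew elements *)

Definition fixed_field : {set K} := [set x | conj x == x].

(** The additive map [f] has its kernel among the roots of X^s - X and its image among those of X^s
    + X. Each has at most s elements, while the product of their sizes is at least s^2. *)
Lemma card_fixed_field : #|fixed_field| = s.
Proof.
pose f x := conj x - x.
have leF : (#|fixed_field| <= s)%N.
  rewrite -ltnS; have sz : size ('X^s - 'X : {poly K}) = s.+1.
    by rewrite size_polyDl ?size_polyXn // size_polyN size_polyX ltnS.
  rewrite -sz; apply: card_roots_leq; first by rewrite -size_poly_eq0 sz.
  by move=> x; rewrite inE rootE !hornerE subr_eq0.
have leI : (#|f @: setT| <= s)%N.
  rewrite -ltnS; have sz : size ('X^s + 'X : {poly K}) = s.+1.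
    by rewrite size_polyDl ?size_polyXn // size_polyX ltnS.
  rewrite -sz; apply: card_roots_leq; first by rewrite -size_poly_eq0 sz.
  move=> _ /imsetP[x _ ->]; rewrite rootE hornerD hornerXn hornerX.
  by rewrite -/(conj _) /f conjB conjK; apply/eqP; ring.
have : (s ^ 2 <= s * #|fixed_field|)%N.
  rewrite -cardK -cardsT -sum1_card (partition_big_imset f) /=.
  apply: (@leq_trans (\sum_(y in f @: setT) #|fixed_field|)).
    apply: leq_sum => y /imsetP[x0 _ ->]; rewrite sum1dep_card.
    rewrite -(card_imset _ (addrI (- x0))); apply: subset_leq_card.
    apply/subsetP => _ /imsetP[x + ->]; rewrite !inE /= /f => /eqP e.
    rewrite addrC conjB -subr_eq0; apply/eqP.
    by rewrite -[RHS](subrr (conj x - x)) {2}e; ring.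
  by rewrite sum_nat_const leq_mul2r leI orbT.
by nia.
Qed.

Lemma skew_exists : exists2 e, e != 0 & conj e = - e.
Proof.
have : ~~ ([set: K] \subset fixed_field).
  apply/negP => /subset_leq_card; rewrite cardsT cardK card_fixed_field.
  by have := s_gt1; nia.
case/subsetPn => x _; rewrite inE => nx; exists (conj x - x).
  by rewrite subr_eq0.
by rewrite conjB conjK opprB.
Qed.

(** The product of two skew elements is fixed by [conj], hence a square. *)
Lemma nonsquare_skew x y : x != 0 -> y != 0 ->
  conj x = - x -> conj y = - y -> nonsquare x = nonsquare y.
Proof.
move=> x0 y0 cx cy; have : nonsquare (x * y) = false.
  by apply: nonsquare_fixed; rewrite conjM cx cy mulrNN.
by rewrite nonsquareM //; do 2![case: nonsquare].
Qed.


(** * Linear algebra in K^3 with the antidiagonal form *)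

Definition vec := (K * K * K)%type.

Implicit Types x y z c : vec.

Definition dot x y : K := x.1.1 * y.2 + x.1.2 * y.1.2 + x.2 * y.1.1.

Definition vconj x : vec := (conj x.1.1, conj x.1.2, conj x.2).

Definition scale (k : K) x : vec := (k * x.1.1, k * x.1.2, k * x.2).

Definition comb (a : K) x (b : K) y : vec :=
  (a * x.1.1 + b * y.1.1, a * x.1.2 + b * y.1.2, a * x.2 + b * y.2).

(** The usual cross product with its coordinates reversed, which makes it orthogonal to both
    arguments for [dot]. *)
Definition cross x y : vec :=
  (x.1.1 * y.1.2 - x.1.2 * y.1.1,
   x.2 * y.1.1 - x.1.1 * y.2,
   x.1.2 * y.2 - x.2 * y.1.2).

Definition vzero : vec := (0, 0, 0).

Lemma vecP x y : x.1.1 = y.1.1 -> x.1.2 = y.1.2 -> x.2 = y.2 -> x = y.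
Proof. by case: x y => [[? ?] ?] [[? ?] ?] /= -> -> ->. Qed.

Lemma vec_neq0 x : x != vzero -> [\/ x.1.1 != 0, x.1.2 != 0 | x.2 != 0].
Proof.
case: x => [[x1 x2] x3]; rewrite /vzero !xpair_eqE -andbA !negb_and /=.
by case/or3P; [constructor 1|constructor 2|constructor 3].
Qed.

Lemma dotC x y : dot x y = dot y x.
Proof. by rewrite /dot; ring. Qed.

Lemma vconjK : involutive vconj.
Proof. by case=> [[? ?] ?]; rewrite /vconj /= !conjK. Qed.

Lemma dot_conj x y : dot (vconj x) (vconj y) = conj (dot x y).
Proof. by rewrite /dot !conjD !conjM. Qed.

Lemma dot_conjl x y : dot (vconj x) y = conj (dot x (vconj y)).
Proof. by rewrite -dot_conj vconjK. Qed.

Lemma dot_scalel k x y : dot (scale k x) y = k * dot x y.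
Proof. by rewrite /dot /=; ring. Qed.

Lemma dot_scaler k x y : dot x (scale k y) = k * dot x y.
Proof. by rewrite /dot /=; ring. Qed.

Lemma dot_combl a x b y z : dot (comb a x b y) z = a * dot x z + b * dot y z.
Proof. by rewrite /dot /=; ring. Qed.

Lemma dot_combr a x b y z : dot z (comb a x b y) = a * dot z x + b * dot z y.
Proof. by rewrite /dot /=; ring. Qed.

Lemma vconj_scale k x : vconj (scale k x) = scale (conj k) (vconj x).
Proof. by rewrite /vconj /scale /= !conjM. Qed.

Lemma vconj_comb a x b y :
  vconj (comb a x b y) = comb (conj a) (vconj x) (conj b) (vconj y).
Proof. by rewrite /vconj /comb /= !conjD !conjM. Qed.

(** Conjugation exchanges the two factors. Hence, if y is a multiple of this product, <z, y> and <z,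
    conj y> have equal norms for every z. *)
Lemma vconj_cross x : vconj (cross x (vconj x)) = scale (-1) (cross x (vconj x)).
Proof. by apply: vecP; rewrite /= conjB !conjM !conjK; ring. Qed.

Lemma parallel y c : c != vzero -> cross y c = vzero -> exists k, y = scale k c.
Proof.
move=> /vec_neq0 c0 [/eqP e1 /eqP e2 /eqP e3].
move: e1 e2 e3; rewrite !subr_eq0 => /eqP e1 /eqP e2 /eqP e3.
case: c0 => c0; [exists (y.1.1 / c.1.1)|exists (y.1.2 / c.1.2)|exists (y.2 / c.2)];
  apply: vecP => /=; rewrite ?divfK // mulrAC.
- by rewrite e1 mulfK.
- by rewrite -e2 mulfK.
- by rewrite -e1 mulfK.
- by rewrite e3 mulfK.
- by rewrite e2 mulfK.
- by rewrite -e3 mulfK.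
Qed.

(** Triple product identity: [cross z (cross x y)] equals <x, z> y - <y, z> x. *)
Lemma perp_cross x y z : cross x y != vzero ->
  dot x z = 0 -> dot y z = 0 -> exists k, z = scale k (cross x y).
Proof.
move=> c0 dx dy; apply: parallel => //; rewrite /cross /vzero /=; congr (_, _, _).
- transitivity (y.1.1 * dot x z - x.1.1 * dot y z); first by rewrite /dot; ring.
  by rewrite dx dy; ring.
- transitivity (y.1.2 * dot x z - x.1.2 * dot y z); first by rewrite /dot; ring.
  by rewrite dx dy; ring.
- transitivity (y.2 * dot x z - x.2 * dot y z); first by rewrite /dot; ring.
  by rewrite dx dy; ring.
Qed.

(** Cramer's rule: a nonzero minor of x, y gives a and b from two coordinates of z, and the
    vanishing determinant [dot z (cross x y)] gives the third coordinate. *)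
Lemma perp_crossE x y z : cross x y != vzero -> dot z (cross x y) = 0 ->
  exists a b, z = comb a x b y.
Proof.
move: x y z => [[x1 x2] x3] [[y1 y2] y3] [[z1 z2] z3] /vec_neq0.
rewrite /dot /comb /= => c0 /eqP d.
case: c0 => c0.
- exists ((z1 * y2 - z2 * y1) / (x1 * y2 - x2 * y1)),
         ((x1 * z2 - x2 * z1) / (x1 * y2 - x2 * y1)).
  apply: vecP => /=; [by field|by field|].
  move: d; rewrite addrC addr_eq0 => /eqP d.
  by apply: (mulIf c0); rewrite d; field.
- exists ((z3 * y1 - z1 * y3) / (x3 * y1 - x1 * y3)),
         ((x3 * z1 - x1 * z3) / (x3 * y1 - x1 * y3)).
  apply: vecP => /=; [by field| |by field].
  move: d; rewrite addrAC addrC addr_eq0 => /eqP d.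
  by apply: (mulIf c0); rewrite d; field.
- exists ((z2 * y3 - z3 * y2) / (x2 * y3 - x3 * y2)),
         ((x2 * z3 - x3 * z2) / (x2 * y3 - x3 * y2)).
  apply: vecP => /=; [|by field|by field].
  move: d; rewrite -addrA addr_eq0 => /eqP d.
  by apply: (mulIf c0); rewrite d; field.
Qed.

(* Coordinates are read from the last one, so the normalized vectors are
   (a, b, 1), (a, 1, 0) and (1, 0, 0): one in each nearfield orbit. *)
Definition lead x : K :=
  if x.2 != 0 then x.2 else if x.1.2 != 0 then x.1.2 else x.1.1.

Definition normalized x : bool := lead x == 1.

Lemma lead_scale k x : lead (scale k x) = k * lead x.
Proof.
rewrite /lead /= !mulf_eq0; case: (eqVneq k 0) => [->|k0] /=.
  by rewrite !mul0r.
by case: (x.2 == 0); case: (x.1.2 == 0).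
Qed.

Lemma lead_conj x : lead (vconj x) = conj (lead x).
Proof. by rewrite /lead /= !conj_eq0; case: (x.2 == 0); case: (x.1.2 == 0). Qed.

Lemma lead_eq0 x : (lead x == 0) = (x == vzero).
Proof.
case: x => [[x1 x2] x3]; rewrite /lead /vzero !xpair_eqE /=.
case e3: (x3 == 0) => /=; last by rewrite e3 andbF.
by case e2: (x2 == 0) => /=; rewrite ?e2 ?andbT ?andbF.
Qed.

Lemma normalized_neq0 x : normalized x -> x != vzero.
Proof. by rewrite -lead_eq0 => /eqP ->; rewrite oner_eq0. Qed.

Lemma normalized_conj x : normalized (vconj x) = normalized x.
Proof. by rewrite /normalized lead_conj -{1}conj1 (inj_eq (inv_inj conjK)). Qed.

Lemma normalized_scale k x : normalized x -> normalized (scale k x) -> k = 1.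
Proof. by rewrite /normalized lead_scale => /eqP -> /eqP; rewrite mulr1. Qed.

Lemma scale1 x : scale 1 x = x.
Proof. by case: x => [[? ?] ?]; rewrite /scale /= !mul1r. Qed.

Lemma normalized_parallel x y :
  normalized x -> normalized y -> cross x y = vzero -> x = y.
Proof.
move=> nx ny /(parallel (normalized_neq0 ny)) [k xk]; move: nx.
by rewrite xk => /(normalized_scale ny) ->; rewrite scale1.
Qed.

Lemma normalized_multiples x y z a b : normalized x -> normalized y ->
  x = scale a z -> y = scale b z -> x = y.
Proof.
move=> nx ny xz yz; apply: normalized_parallel => //.
by rewrite xz yz; apply: vecP; rewrite /=; ring.
Qed.

(** * Nearfield multiplication and incidence *)

(* [near A B] says that the map k |-> A k + B k^s is left multiplication by an
   element of the Dickson nearfield on K. *)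
Definition near (A B : K) : bool :=
  (B == 0) && ~~ nonsquare A || (A == 0) && nonsquare B.

Definition incident x y : bool := near (dot x y) (dot x (vconj y)).

Lemma near_conjr A B : near A (conj B) = near A B.
Proof. by rewrite /near conj_eq0 nonsquare_conj. Qed.

(** Exchanging the arguments conjugates B, and [near] is insensitive to that. *)
Lemma incidentC x y : incident x y = incident y x.
Proof.
by rewrite /incident dotC -[RHS]near_conjr -dot_conjl [dot (vconj _) _]dotC.
Qed.

Lemma near_scale g A B : g != 0 -> ~~ nonsquare g ->
  near (g * A) (g * B) = near A B.
Proof.
move=> g0 /negPf gs; have E u : nonsquare (g * u) = nonsquare u.
  case: (eqVneq u 0) => [->|u0]; first by rewrite mulr0.
  by rewrite nonsquareM // gs.
by rewrite /near !E !mulf_eq0 (negPf g0).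
Qed.

Lemma near_swap g A B : g != 0 -> nonsquare g ->
  near (g * B) (g * A) = near A B.
Proof.
move=> g0 gs; rewrite /near !mulf_eq0 (negPf g0) /=.
case: (eqVneq A 0) => [->|A0]; case: (eqVneq B 0) => [->|B0];
  rewrite ?mulr0 ?nonsquare0 ?nonsquareM ?gs //=.
all: by rewrite ?orbF ?negbK.
Qed.

(** Left nearfield multiplication by g, coordinatewise. *)
Definition act (g : K) x : vec :=
  if nonsquare g then scale g (vconj x) else scale g x.

(** Incidence is well defined on nearfield orbits: a nonsquare g exchanges A and B up to
    conjugation, but also exchanges squares and nonsquares. *)
Lemma incident_actl g x y : g != 0 -> incident (act g x) y = incident x y.
Proof.
move=> g0; rewrite /incident /act; case: ifP => gs.
  rewrite !dot_scalel dot_conjl dot_conj near_swap //.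
  by rewrite near_conjr /near conj_eq0 nonsquare_conj.
by rewrite !dot_scalel near_scale ?gs.
Qed.

Lemma incident_actr g x y : g != 0 -> incident x (act g y) = incident x y.
Proof. by move=> g0; rewrite ![incident x _]incidentC incident_actl. Qed.

Lemma lead_act g x :
  lead (act g x) = g * (if nonsquare g then conj (lead x) else lead x).
Proof. by rewrite /act; case: ifP; rewrite lead_scale ?lead_conj. Qed.

Lemma act_inv g : g != 0 -> exists2 h, h != 0 & forall x, act g (act h x) = x.
Proof.
move=> g0; have gg x k : g * (g^-1 * k) = k by rewrite mulrA divff // mul1r.
case gs: (nonsquare g).
  (* For nonsquare g, [act g] conjugates its argument, so the inverse h must satisfy g * conj h =
     1. *)
  exists (conj g^-1); first by rewrite conj_eq0 invr_eq0.
  move=> x; rewrite /act nonsquare_conj nonsquareV gs vconj_scale conjK vconjK.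
  by apply: vecP; rewrite /= gg.
exists g^-1; first by rewrite invr_eq0.
by move=> x; rewrite /act nonsquareV gs; apply: vecP; rewrite /= gg.
Qed.

Lemma act_inj g : g != 0 -> injective (act g).
Proof.
move=> g0 x y; rewrite /act; case: ifP => _ e; last first.
  by case: e => /(mulfI g0) ? /(mulfI g0) ? /(mulfI g0) ?; apply: vecP.
case: e => /(mulfI g0) /(inv_inj conjK) ? /(mulfI g0) /(inv_inj conjK) ?.
by move=> /(mulfI g0) /(inv_inj conjK) ?; apply: vecP.
Qed.

Lemma act_normalized g h x y : g != 0 -> normalized x -> normalized y ->
  act g x = act h y -> x = y.
Proof.
move=> g0 nx ny e; have := congr1 lead e; rewrite !lead_act.
rewrite (eqP nx) (eqP ny) conj1 !if_same !mulr1 => gh.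
by apply: (act_inj g0); rewrite e gh.
Qed.

Lemma norm_eq0 (u : K) : u * conj u = 0 -> u = 0.
Proof. by move/eqP; rewrite mulf_eq0 conj_eq0 orbb => /eqP. Qed.

(* The difference of two distinct nearfield multiplications is invertible. *)
Lemma near_diff A B A' B' : near A B -> near A' B' ->
  (A - A') * conj (A - A') = (B - B') * conj (B - B') -> A = A' /\ B = B'.
Proof.
case/orP => /andP[/eqP -> sA]; case/orP => /andP[/eqP -> sA'].
- rewrite subrr mul0r => /norm_eq0 /eqP; rewrite subr_eq0 => /eqP //.
(* In the two mixed cases equal norms would equate values of [nonsquare] that differ. *)
- rewrite subr0 sub0r conjN mulrNN => /nonsquare_norm e.
  by rewrite -e (negPf sA) in sA'.
- rewrite subr0 sub0r conjN mulrNN => /nonsquare_norm e.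
  by rewrite e sA in sA'.
- rewrite subrr mul0r => /esym /norm_eq0 /eqP; rewrite subr_eq0 => /eqP //.
Qed.

Lemma near_norm A B : near A B -> A * conj A = B * conj B -> A = 0 /\ B = 0.
Proof.
move=> nAB e; apply: near_diff nAB _ _; last by rewrite !subr0.
by rewrite /near eqxx nonsquare0.
Qed.

(** * Two points are joined by at most one line *)

Lemma incident_fixed x y : vconj x = x -> incident x y -> dot x y = 0.
Proof.
move=> cx /near_norm[] //.
(* For a real point B is the conjugate of A, so their norms agree. *)
by rewrite -[in dot x (vconj y)]cx dot_conj conjK mulrC.
Qed.

(** Here y is a multiple of w, so the two products of x' with y have equal norms and vanish by
    [near_norm]; thus x' is orthogonal to w. *)
Lemma incident_perp x x' y : cross x (vconj x) != vzero -> normalized y ->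
  dot x y = 0 -> dot x (vconj y) = 0 -> incident x' y ->
  exists a b, x' = comb a x b (vconj x).
Proof.
set w := cross _ _ => w0 ny d1 d2 I'.
have [k yk] : exists k, y = scale k w.
  by apply: perp_cross => //; rewrite dot_conjl d2 conj0.
have k0 : k != 0.
  apply: contraTneq ny => k0.
  by rewrite /normalized yk k0 lead_scale mul0r eq_sym oner_eq0.
apply: perp_crossE => //; rewrite -/w.
have [] := near_norm I'.
  rewrite yk vconj_scale vconj_cross -/w !dot_scaler !conjM conjN conj1 conjK.
  by ring.
by rewrite yk dot_scaler => /eqP; rewrite mulf_eq0 (negPf k0) => /eqP.
Qed.

(** Exactly one of A, B is nonzero, so incidence of x' forces b = 0, or a = 0 with b a nonsquare.
    Either way x' is a nearfield multiple of x, and both are normalized. *)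
Lemma incident_comb x x' y a b : normalized x -> normalized x' ->
  x' = comb a x b (vconj x) -> (dot x y != 0) || (dot x (vconj y) != 0) ->
  incident x y -> incident x' y -> x' = x.
Proof.
move=> nx nx' e d I1 I2.
have caseb : b = 0 -> x' = x.
  move=> b0; have xa : x' = scale a x.
    by rewrite e b0; apply: vecP; rewrite /=; ring.
  by apply: (normalized_multiples nx' nx xa); rewrite -[LHS]scale1.
have casea : a = 0 -> nonsquare b \/ b = 0 -> x' = x.
  move=> a0; have xb : x' = scale b (vconj x).
    by rewrite e a0; apply: vecP; rewrite /=; ring.
  move: nx'; rewrite xb -normalized_conj in nx * => /(normalized_scale nx) ->.
  by rewrite nonsquare1; case=> // /eqP; rewrite oner_eq0.
rewrite e in I2; move: I1 I2 d; rewrite /incident !dot_combl dot_conj dot_conjl.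
set A := dot x y; set B := dot x (vconj y).
case/orP => /andP[/eqP -> sA]; rewrite ?conj0 ?mulr0 ?addr0 ?add0r eqxx ?orbF /=.
- move=> n A0; have cA0 : conj A != 0 by rewrite conj_eq0.
  case/orP: n => /andP[].
    by rewrite mulf_eq0 (negPf cA0) orbF => /eqP /caseb.
  rewrite mulf_eq0 (negPf A0) orbF => /eqP a0 nb; apply: casea => //.
  case: (eqVneq b 0) => [|b0]; [by right|left].
  by rewrite nonsquareM // nonsquare_conj (negPf sA) addbF in nb.
- move=> n B0; have cB0 : conj B != 0 by rewrite conj_eq0.
  case/orP: n => /andP[].
    rewrite mulf_eq0 (negPf B0) orbF => /eqP a0 nb; apply: casea => //.
    case: (eqVneq b 0) => [|b0]; [by right|left].
    rewrite nonsquareM // nonsquare_conj sA addbT in nb.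
    by rewrite negbK in nb.
  by rewrite mulf_eq0 (negPf cB0) orbF => /eqP /caseb.
Qed.

(** Brings (A, B) to (1, 0), so that two lines through x can be subtracted. *)
Lemma incident_rescale x y : (dot x y != 0) || (dot x (vconj y) != 0) ->
  incident x y -> exists2 g, g != 0 &
    dot x (act g y) = 1 /\ dot x (vconj (act g y)) = 0.
Proof.
rewrite /incident; set A := dot x y; set B := dot x (vconj y).
move=> d /orP[] /andP[/eqP e n]; rewrite e eqxx ?orbF /= in d.
- exists A^-1; first by rewrite invr_eq0.
  rewrite /act nonsquareV (negPf n) vconj_scale !dot_scaler -/A -/B e mulr0.
  by rewrite mulVf.
- exists B^-1; first by rewrite invr_eq0.
  rewrite /act nonsquareV n vconj_scale vconjK !dot_scaler -/A -/B e mulr0.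
  by rewrite mulVf.
Qed.

Lemma incident_uniq_nonreal x x' y y' :
  normalized x -> normalized x' -> normalized y -> normalized y' ->
  cross x (vconj x) != vzero ->
  incident x y -> incident x y' -> incident x' y -> incident x' y' ->
  x = x' \/ y = y'.
Proof.
move=> nx nx' ny ny' w0 I1 I2 I3 I4.
have perp u : dot x (vconj u) = 0 -> dot (vconj x) u = 0.
  by rewrite dot_conjl => ->; rewrite conj0.
case: (boolP ((dot x y != 0) || (dot x (vconj y) != 0))) => [d|];
  case: (boolP ((dot x y' != 0) || (dot x (vconj y') != 0))) => [d'|]; last first.
(* Both lines are orthogonal to x and its conjugate, hence multiples of one vector. *)
- rewrite !negb_or !negbK => /andP[/eqP e1 /eqP e2] /andP[/eqP e3 /eqP e4].
  right; have [k yk] := perp_cross w0 e3 (perp _ e4).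
  have [k' yk'] := perp_cross w0 e1 (perp _ e2).
  exact: normalized_multiples yk yk'.
- rewrite negb_or !negbK => /andP[/eqP e1 /eqP e2]; left; apply/esym.
  have [a [b e]] := incident_perp w0 ny e1 e2 I3.
  exact: incident_comb e d' I2 I4.
- rewrite negb_or !negbK => /andP[/eqP e1 /eqP e2]; left; apply/esym.
  have [a [b e]] := incident_perp w0 ny' e1 e2 I4.
  exact: incident_comb e d I1 I3.
have [g g0 [g1 g2]] := incident_rescale d I1.
have [h h0 [h1 h2]] := incident_rescale d' I2.
(* Both rescaled lines have products (1, 0) with x, so D is orthogonal to x and to its conjugate. *)
pose D := comb 1 (act g y) (-1) (act h y').
have dD z : dot z D = dot z (act g y) - dot z (act h y').
  by rewrite dot_combr mul1r mulN1r.
have dcD z : dot z (vconj D) = dot z (vconj (act g y)) - dot z (vconj (act h y')).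
  by rewrite vconj_comb conjN conj1 dot_combr mul1r mulN1r.
have [k Dk] : exists k, D = scale k (cross x (vconj x)).
  apply: perp_cross => //; first by rewrite dD g1 h1 subrr.
  by apply: perp; rewrite dcD g2 h2 subrr.
case: (eqVneq k 0) => [k0|k0].
  right; apply: (act_normalized (h := h) g0 ny ny'); move: Dk; rewrite k0.
  case=> /eqP e1 /eqP e2 /eqP e3; move: e1 e2 e3.
  rewrite !mul0r !mul1r !mulN1r !subr_eq0 => /eqP ? /eqP ? /eqP ?.
  exact: vecP.
left; apply/esym.
have [a [b e]] : exists a b, x' = comb a x b (vconj x).
  apply: perp_crossE => //.
  (* As D is a multiple of a skew vector, the differences of the two products at x' have equal
     norms. *)
  have [|||e _] := @near_diff (dot x' (act g y)) (dot x' (vconj (act g y)))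
    (dot x' (act h y')) (dot x' (vconj (act h y'))).
  - by rewrite -/(incident _ _) incident_actr.
  - by rewrite -/(incident _ _) incident_actr.
  - rewrite -dD -dcD Dk vconj_scale vconj_cross !dot_scaler !conjM conjN conj1.
    by rewrite conjK; ring.
  have : dot x' D = 0 by rewrite dD e subrr.
  by rewrite Dk dot_scaler => /eqP; rewrite mulf_eq0 (negPf k0) => /eqP.
exact: incident_comb e d I1 I3.
Qed.

(** If both x and x' are real, incidence with them is linear and both lines are multiples of
    [cross x x']. *)
Lemma incident_uniq x x' y y' :
  normalized x -> normalized x' -> normalized y -> normalized y' ->
  incident x y -> incident x y' -> incident x' y -> incident x' y' ->
  x = x' \/ y = y'.
Proof.
move=> nx nx' ny ny' I1 I2 I3 I4.
have [wx|wx] := eqVneq (cross x (vconj x)) vzero; last first.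
  exact: incident_uniq_nonreal I1 I2 I3 I4.
have [wx'|wx'] := eqVneq (cross x' (vconj x')) vzero; last first.
  by case: (incident_uniq_nonreal nx' nx ny ny' wx' I3 I4 I1 I2) => ->; [left|right].
have fx : vconj x = x.
  by apply/esym/normalized_parallel; rewrite ?normalized_conj.
have fx' : vconj x' = x'.
  by apply/esym/normalized_parallel; rewrite ?normalized_conj.
have [/(normalized_parallel nx nx')|w0] := eqVneq (cross x x') vzero; first by left.
right; have [k yk] := perp_cross w0 (incident_fixed fx I1) (incident_fixed fx' I3).
have [k' yk'] := perp_cross w0 (incident_fixed fx I2) (incident_fixed fx' I4).
exact: normalized_multiples yk yk'.
Qed.

(** * Counting nearfield orbits and solutions of incidence *)

Lemma card_vec : #|{: vec}| = ((s ^ 2) ^ 3)%N.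
Proof. by rewrite !card_prod cardK -mulnA [in RHS]expnS -mulnn. Qed.

(** [act g] carries the normalized members of V bijectively onto those with leading coordinate g, so
    all q - 1 fibres of [lead] have the same size. *)
Lemma card_invariant (V : {set vec}) : vzero \notin V ->
  (forall (g : K) x, g != 0 -> (act g x \in V) = (x \in V)) ->
  #|V| = ((s ^ 2 - 1) * #|[set x in V | normalized x]|)%N.
Proof.
move=> V0 Vact; rewrite -sum1_card (partition_big lead (fun a : K => a != 0)) /=; last first.
  by move=> x; rewrite lead_eq0; apply: contraTneq => ->.
rewrite (eq_bigr (fun _ => #|[set x in V | normalized x]|)) => [|g g0].
  rewrite sum_nat_const; congr (_ * _)%N.
  by rewrite -cardK subn1 -(cardC1 (0 : K)); apply: eq_card.
rewrite sum1dep_card -[RHS](card_imset _ (act_inj g0)); apply: eq_card => x.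
rewrite [LHS]inE; apply/andP/imsetP => [[xV /eqP lx]|[y]]; last first.
  rewrite inE => /andP[yV /eqP ny] ->.
  by rewrite Vact // lead_act ny conj1 if_same mulr1.
have [h h0 gh] := act_inv g0; exists (act h x); last by rewrite gh.
rewrite inE Vact // xV /=; have := lead_act g (act h x).
rewrite gh lx -{1}[g]mulr1 => /(mulfI g0) /esym /eqP.
by case: ifP => _ //; rewrite -{1}conj1 (inj_eq (inv_inj conjK)).
Qed.

(** Together with a coordinate of z whose complementary minor is nonzero, the two products determine
    z; that coordinate remains free. *)
Lemma card_preim_dot x y (R : rel K) : cross x y != vzero ->
  #|[set z | R (dot z x) (dot z y)]| = (#|[set u : K * K | R u.1 u.2]| * s ^ 2)%N.
Proof.
move=> /vec_neq0 c0.
suff [phi phi_inj phi_dot] : exists2 phi : vec -> vec, injective phi &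
    forall z, (phi z).1 = (dot z x, dot z y).
  rewrite -cardK -[#|K|]cardsT -cardsX.
  rewrite -[RHS](card_preimset _ phi_inj); apply: eq_card => z.
  by rewrite !inE phi_dot andbT.
have solve (m u v a b c d : K) : m != 0 -> m = a * d - b * c ->
    u * a + v * b = 0 -> u * c + v * d = 0 -> u = 0 /\ v = 0.
  move=> m0 mE e1 e2; split; apply: (mulIf m0); rewrite mul0r mE.
    transitivity ((u * a + v * b) * d - (u * c + v * d) * b); first by ring.
    by rewrite e1 e2; ring.
  transitivity ((u * c + v * d) * a - (u * a + v * b) * c); first by ring.
  by rewrite e1 e2; ring.
have diff0 (u v : K) : u - v = 0 -> u = v by move/eqP; rewrite subr_eq0 => /eqP.
case: c0 => c0.
- exists (fun z => (dot z x, dot z y, z.1.1)) => // z t [e1 e2 e3].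
  have [] := solve _ (t.1.2 - z.1.2) (t.2 - z.2) x.1.2 x.1.1 y.1.2 y.1.1 _ erefl.
  + by apply: contraNneq c0 => e; apply/eqP; rewrite /= -[RHS]oppr0 -e; ring.
  + transitivity (dot t x - dot z x + (z.1.1 - t.1.1) * x.2).
      by rewrite /dot; ring.
    by rewrite e1 e3; ring.
  + transitivity (dot t y - dot z y + (z.1.1 - t.1.1) * y.2).
      by rewrite /dot; ring.
    by rewrite e2 e3; ring.
  by move=> /diff0 f1 /diff0 f2; apply: vecP.
- exists (fun z => (dot z x, dot z y, z.1.2)) => // z t [e1 e2 e3].
  have [] := solve _ (t.1.1 - z.1.1) (t.2 - z.2) x.2 x.1.1 y.2 y.1.1 _ erefl.
  + by apply: contraNneq c0 => e; apply/eqP; rewrite /= -e; ring.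
  + transitivity (dot t x - dot z x + (z.1.2 - t.1.2) * x.1.2).
      by rewrite /dot; ring.
    by rewrite e1 e3; ring.
  + transitivity (dot t y - dot z y + (z.1.2 - t.1.2) * y.1.2).
      by rewrite /dot; ring.
    by rewrite e2 e3; ring.
  by move=> /diff0 f1 /diff0 f2; apply: vecP.
- exists (fun z => (dot z x, dot z y, z.2)) => // z t [e1 e2 e3].
  have [] := solve _ (t.1.1 - z.1.1) (t.1.2 - z.1.2) x.2 x.1.2 y.2 y.1.2 _ erefl.
  + by apply: contraNneq c0 => e; apply/eqP; rewrite /= -[RHS]oppr0 -e; ring.
  + transitivity (dot t x - dot z x + (z.2 - t.2) * x.1.1).
      by rewrite /dot; ring.
    by rewrite e1 e3; ring.
  + transitivity (dot t y - dot z y + (z.2 - t.2) * y.1.1).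
      by rewrite /dot; ring.
    by rewrite e2 e3; ring.
  by move=> /diff0 f1 /diff0 f2; apply: vecP.
Qed.

(** Each element of K is placed in the slot dictated by its character, giving one pair per nearfield
    element. *)
Lemma card_near : #|[set u : K * K | near u.1 u.2]| = (s ^ 2)%N.
Proof.
pose f (a : K) := if nonsquare a then (0, a) else (a, 0).
have f_inj : injective f.
  move=> a b; rewrite /f; case: ifP => na; case: ifP => nb [] //.
    by move=> e1 e2; rewrite e2 nonsquare0 in na.
  by move=> e1 e2; rewrite -e2 nonsquare0 in nb.
rewrite -cardK -cardsT -(card_imset _ f_inj); apply: eq_card => -[a b].
rewrite inE /near /=; apply/orP/imsetP => [|[k _]].
  case=> /andP[/eqP -> n]; [exists a|exists b] => //; rewrite /f ?n //.
  by rewrite (negPf n).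
by rewrite /f; case: ifP => nk [-> ->]; rewrite eqxx ?nk; [right|left].
Qed.

Lemma cross_neq0_exists x : x != vzero -> exists y, cross x y != vzero.
Proof.
have nz y : [|| y.1.1 != 0, y.1.2 != 0 | y.2 != 0] -> y != vzero.
  by apply: contraTneq => ->; rewrite /= eqxx.
move=> /vec_neq0[] x0; [exists (0, 1, 0)|exists (1, 0, 0)|exists (1, 0, 0)];
  apply: nz; rewrite /= ?(mulr0, mulr1, subr0, sub0r, oppr_eq0) x0 ?orbT //.
Qed.

(** For nonreal y, A and B are independent functionals of x with q admissible pairs of values; for
    real y, incidence is the single equation A = 0. Both give q^2 vectors, zero included. *)
Lemma card_incident_vec y : normalized y ->
  #|[set x | (x != vzero) && incident x y]| = (s ^ 2 * s ^ 2 - 1)%N.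
Proof.
move=> ny.
have inc0 : incident vzero y.
  by rewrite /incident /near /dot /= !mul0r !addr0 eqxx nonsquare0.
suff <- : #|[set x | incident x y]| = (s ^ 2 * s ^ 2)%N.
  rewrite [X in (X - _)%N](cardsD1 vzero) inE inc0 addnC addnK; by apply: eq_card => x; rewrite !inE.
have [w|w0] := eqVneq (cross y (vconj y)) vzero; last first.
  rewrite -{1}card_near -(card_preim_dot _ w0).
  by apply: eq_card => x; rewrite !inE.
have fy : vconj y = y by apply/esym/normalized_parallel; rewrite ?normalized_conj.
have [z yz] := cross_neq0_exists (normalized_neq0 ny).
rewrite -[X in (X * _)%N](_ : #|[set u : K * K | u.1 == 0%R]| = _).
  rewrite -(card_preim_dot (fun a b => a == 0) yz).
  apply: eq_card => x; rewrite !inE; apply/idP/eqP => [|d].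
    by rewrite incidentC dotC; apply: incident_fixed.
  by rewrite /incident fy d /near eqxx nonsquare0.
have -> : [set u : K * K | u.1 == 0] = setX [set 0] [set: K].
  by apply/setP => u; rewrite !inE andbT.
by rewrite cardsX cards1 cardsT cardK mul1n.
Qed.

(** * The Hughes plane and its polarity *)

Definition point := {x : vec | normalized x}.

Definition point_incident (x y : point) : bool := incident (val x) (val y).

Lemma point_incidentC (x y : point) : point_incident x y = point_incident y x.
Proof. exact: incidentC. Qed.

Lemma act_eq0 (g : K) x : g != 0 -> (act g x == vzero) = (x == vzero).
Proof.
move=> g0; rewrite -!lead_eq0 lead_act mulf_eq0 (negPf g0).
by case: ifP; rewrite ?conj_eq0.
Qed.

Lemma card_points (Q : pred vec) :
  (forall (g : K) x, g != 0 -> Q (act g x) = Q x) ->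
  #|[set x | (x != vzero) && Q x]| =
    ((s ^ 2 - 1) * #|[set x : point | Q (val x)]|)%N.
Proof.
move=> Qact; rewrite card_invariant.
- congr (_ * _)%N; rewrite -[RHS](card_imset _ val_inj); apply: eq_card => x.
  rewrite !inE; apply/andP/imsetP => [[/andP[_ Qx] nx]|[y]].
    by exists (exist _ x nx : point); rewrite ?inE.
  rewrite inE => Qy ->; split; last exact: valP.
  by rewrite Qy normalized_neq0 // (valP y).
- by rewrite inE eqxx.
- by move=> g x g0; rewrite !inE act_eq0 // Qact.
Qed.

Lemma card_point : #|{: point}| = ((s ^ 2).+1 * s ^ 2).+1.
Proof.
have := @card_points predT (fun _ _ _ => erefl).
have -> : [set x | (x != vzero) && predT x] = [set~ vzero].
  by apply/setP => x; rewrite !inE andbT.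
have -> : [set x : point | predT (val x)] = [set: point].
  by apply/setP => x; rewrite !inE.
rewrite cardsC1 card_vec cardsT.
have : (1 < s ^ 2)%N by have := s_gt1; nia.
by move: #|_| (s ^ 2)%N => N t; rewrite !expnS expn0; nia.
Qed.

Lemma card_point_line (y : point) :
  #|[set x : point | point_incident x y]| = (s ^ 2).+1.
Proof.
have := @card_points (incident^~ (val y)) (fun g x => @incident_actl g x (val y)).
rewrite card_incident_vec ?(valP y) // -/(point_incident _ _).
have : (1 < s ^ 2)%N by have := s_gt1; nia.
by move: #|_| (s ^ 2)%N => N t; nia.
Qed.

Lemma point_join_leq1 (x y : point) : x != y ->
  (#|[set l | point_incident x l && point_incident y l]| <= 1)%N.
Proof.
move=> xy; apply/card_le1_eqP => l m; rewrite !inE => /andP[xl yl] /andP[xm ym].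
apply/val_inj.
case: (incident_uniq (valP x) (valP y) (valP l) (valP m) xl xm yl ym) => // e.
by rewrite (val_inj e) eqxx in xy.
Qed.

(** Counting turns at most one join into exactly one; the statement on meets follows by symmetry of
    incidence. *)
Lemma hughes_plane : projective_plane_of_order point_incident (s ^ 2).
Proof.
have pencil (x : point) : #|[set l | point_incident x l]| = (s ^ 2).+1.
  rewrite -(card_point_line x); apply: eq_card => l.
  by rewrite !inE point_incidentC.
have join := join_eq1 card_point card_point_line pencil point_join_leq1.
split; [by have := s_gt1; nia|exact: join| |exact: card_point_line|exact: pencil].
move=> l m lm; rewrite -(join _ _ lm); apply: eq_card => x.
by rewrite !inE ![point_incident x _]point_incidentC.
Qed.

Lemma hughes_polarity : polarity point_incident id id.
Proof. by split=> // x l; apply: point_incidentC. Qed.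

(** * Absolute points: independence and number *)

Definition affine (a b : K) : vec := (a, b, 1).

Definition at_infinity : vec := (1, 0, 0).

(** At x = (a, b, 1) the two expressions are <x, conj x> and <x, x>. *)
Definition absolute_pair (a b : K) : bool :=
  (a + conj a + b * conj b == 0) && ~~ nonsquare (2%:R * a + b ^+ 2).

Lemma absoluteE x : normalized x && incident x x =
  (x == at_infinity) || (x == affine x.1.1 x.1.2) && absolute_pair x.1.1 x.1.2.
Proof.
(* <x, conj x> is fixed by [conj], hence never a nonsquare, so the second alternative of [near]
   cannot occur. *)
have -> : incident x x = (dot x (vconj x) == 0) && ~~ nonsquare (dot x x).
  rewrite /incident /near [nonsquare (dot x (vconj x))]nonsquare_fixed.
    by rewrite andbF orbF.
  by rewrite -dot_conj vconjK dotC.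
case: x => [[x1 x2] x3]; rewrite /normalized /lead /at_infinity /affine.
rewrite /absolute_pair /dot !xpair_eqE /= !eqxx /=.
case: (eqVneq x3 0) => [->|x30] /=.
  rewrite [0 == 1]eq_sym oner_eq0 /= conj0 !mulr0 !mul0r add0r !addr0 orbF !andbT.
  rewrite mulf_eq0 conj_eq0 orbb.
  case: (eqVneq x2 0) => [->|] /=; last by rewrite !andbF.
  by rewrite mulr0 addr0 nonsquare0 !andbT.
rewrite andbF /=; case: eqVneq => //= ->; rewrite conj1 !mulr1 mul1r.
by congr ((_ == _) && ~~ nonsquare _); ring.
Qed.

(** The first two forms minus the third and its conjugate leave the norm of b - b'. *)
Lemma isotropic_perp_eq (a b a' b' : K) :
  a + conj a + b * conj b = 0 -> a' + conj a' + b' * conj b' = 0 ->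
  a + conj a' + b * conj b' = 0 -> a = a' /\ b = b'.
Proof.
move=> e1 e2 e3; have := congr1 conj e3; rewrite conj0 !conjD conjM !conjK => e4.
have /eqP : b - b' = 0.
  apply: norm_eq0; rewrite conjB.
  transitivity ((a + conj a + b * conj b) + (a' + conj a' + b' * conj b')
    - (a + conj a' + b * conj b') - (conj a + a' + conj b * b')); first by ring.
  by rewrite e1 e2 e3 e4; ring.
rewrite subr_eq0 => /eqP bb; split=> //; apply: (inv_inj conjK).
by move: e1; rewrite -e3 -bb => /addIr /addrI.
Qed.

Lemma absolute_independent x y : normalized x -> normalized y ->
  incident x x -> incident y y -> incident x y -> x = y.
Proof.
have inf a b : ~~ incident at_infinity (affine a b).
  rewrite /incident /near /dot /= conj1 !mul1r !mul0r !addr0.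
  by rewrite oner_eq0.
move=> nx ny ix iy.
have : normalized x && incident x x by rewrite nx.
have : normalized y && incident y y by rewrite ny.
case: x y {nx ny ix iy} => [[a b] u] [[a' b'] u']; rewrite !absoluteE /=.
case/orP => [/eqP ->|/andP[/eqP -> /andP[/eqP h' _]]];
  case/orP => [/eqP ->|/andP[/eqP -> /andP[/eqP h n]]] //.
- by rewrite incidentC (negPf (inf _ _)).
- by rewrite (negPf (inf _ _)).
rewrite /incident /near /dot /= conj1 !mulr1 !mul1r.
case/orP => /andP[/eqP e].
  by rewrite addrAC in e; have [-> ->] := isotropic_perp_eq h h' e.
(* When A = 0, x is the conjugate of y, so B becomes <x, x>, which is not a nonsquare because x is
   absolute. *)
have [|||-> ->] := @isotropic_perp_eq (conj a') (conj b') a b.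
- by rewrite !conjK -h'; ring.
- exact: h.
- by rewrite -conj0 -e !conjD conjM; ring.
by rewrite (_ : _ + _ = 2%:R * a + b ^+ 2) ?(negPf n) //; ring.
Qed.

(** With D = 2a + b^2 = z * delta for a skew delta, the Hermitian condition says that z - b is
    fixed, and the square condition concerns z * e. So (a, b) is traded for (z * e, z - b), ranging
    over squares times the fixed field. *)
Lemma card_absolute_pair :
  (#|[set u : K * K | absolute_pair u.1 u.2]| * 2 = s * (s ^ 2 + 1))%N.
Proof.
have [e e0 ce] := skew_exists.
(* [b - conj b] is the natural skew divisor; [e] replaces it where it vanishes. *)
pose delta (b : K) := if conj b == b then e else b - conj b.
have delta0 b : delta b != 0.
  by rewrite /delta; case: ifPn => //; rewrite subr_eq0 eq_sym.
have cdelta b : conj (delta b) = - delta b.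
  by rewrite /delta; case: ifP => // _; rewrite conjB conjK opprB.
pose phi (u : K * K) := ((2%:R * u.1 + u.2 ^+ 2) / delta u.2, u.2).
have phi_inj : injective phi.
  move=> [a b] [a' b'] [+ bb]; rewrite -bb => /(divIf (delta0 b)) /addIr.
  by move=> /(mulfI two_neq0) ->.
pose psi (u : K * K) := (u.1 * e, u.1 - u.2).
have psi_inj : injective psi.
  by move=> [a b] [a' b'] [/(mulIf e0) ->] /addrI /oppr_inj ->.
pose T := setX [set z | ~~ nonsquare z] fixed_field.
suff -> : #|[set u : K * K | absolute_pair u.1 u.2]| = #|T|.
  have := card_nonsquare; have := cardsC [set z | nonsquare z].
  rewrite cardK cardsX card_fixed_field.
  have -> : ~: [set z | nonsquare z] = [set z | ~~ nonsquare z].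
    by apply/setP => z; rewrite !inE.
  have : (0 < s ^ 2)%N by rewrite expn_gt0 ltnW.
  set m := #|_|; set k := #|_|; set t := (s ^ 2)%N => t0 e1 e2.
  by have : (k * 2 = t + 1)%N; [lia | nia].
rewrite -[RHS](card_preimset _ psi_inj) -[RHS](card_preimset _ phi_inj).
apply: eq_card => -[a b]; rewrite !inE /= /absolute_pair andbC.
set D := _ + b ^+ 2; set z := D / delta b.
have Dz : D = z * delta b by rewrite divfK.
congr (_ && _).
  case: (eqVneq z 0) => [z0|z0]; first by rewrite Dz z0 !mul0r.
  by rewrite Dz (nonsquareM z0 (delta0 b)) (nonsquareM z0 e0)
    (nonsquare_skew (delta0 b) e0).
have dd : (b - conj b) ^+ 2 = (b - conj b) * delta b.
  by rewrite /delta; case: eqP => [->|_]; rewrite expr2 // subrr !mul0r.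
have conj2 : conj 2%:R = 2%:R by rewrite (natrD _ 1 1) conjD conj1.
have trD : 2%:R * (a + conj a + b * conj b) =
    (z - conj z - (b - conj b)) * delta b.
  transitivity (D + conj D - (b - conj b) ^+ 2).
    by rewrite /D expr2 conjD !conjM conj2; ring.
  by rewrite dd Dz conjM cdelta; ring.
rewrite -(inj_eq (mulfI two_neq0)) mulr0 trD mulf_eq0 (negPf (delta0 b)) orbF.
by rewrite conjB -[RHS]subr_eq0 -oppr_eq0; congr (_ == 0); ring.
Qed.

Lemma card_absolute_points :
  (#|absolute_points point_incident id| * 2 = s * (s ^ 2 + 1) + 2)%N.
Proof.
have affine_inj : injective (fun u : K * K => affine u.1 u.2).
  by move=> [? ?] [? ?] [-> ->].
have -> : #|absolute_points point_incident id| =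
    #|at_infinity |: [set affine u.1 u.2 | u in [set u | absolute_pair u.1 u.2]]|.
  rewrite -(card_imset _ val_inj); apply: eq_card => x; rewrite in_setU1.
  transitivity (normalized x && incident x x).
    apply/imsetP/andP => [[y]|[nx ix]].
      by rewrite inE => iy ->; split=> //; apply: valP.
    by exists (exist _ x nx : point); rewrite ?inE.
  rewrite absoluteE; congr (_ || _); apply/andP/imsetP => [[/eqP -> ap]|[u]].
    by exists (x.1.1, x.1.2); rewrite ?inE.
  by rewrite inE => ap ->; split.
rewrite cardsU1 (card_imset _ affine_inj) mulnDl card_absolute_pair addnC.
congr (_ + _)%N; rewrite (_ : _ \notin _) //; apply/imsetP => -[u _] [_ _ /eqP].
by rewrite eq_sym oner_eq0.
Qed.

Lemma absolute_points_independent :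
  independent_set point_incident id (absolute_points point_incident id).
Proof.
apply/forall_inP => x; rewrite inE => ix; apply/forall_inP => y.
rewrite inE => iy; apply/negP => /andP[/negP xy ixy]; apply: xy; apply/eqP.
by apply/val_inj/absolute_independent; rewrite ?(valP x) ?(valP y).
Qed.

End HughesPlane.

Local Close Scope ring_scope.

(** * Choice of the field and comparison of cardinalities *)

Theorem theorem2 (p n : nat) :
  prime p -> odd p -> 1 <= n ->
  let q := p ^ (2 * n) in
  exists (P L : finType) (I : P -> L -> bool) (f : P -> L) (g : L -> P),
    [/\ projective_plane_of_order I q,
        polarity I f g,
        ~ orthogonal_polarity I q f,
        ~ unitary_polarity I q f &
        q * (p ^ n - 1) <= 2 * independence_number I f].
Proof.
move=> p_pr p_odd n_gt0 q.
have n2_gt0 : 0 < 2 * n by rewrite muln_gt0.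
have [K charK cardK] := pPrimePowerField p_pr n2_gt0.
pose s := p ^ n.
have qE : q = s ^ 2 by rewrite /q mulnC expnM.
have s_odd : odd s by rewrite oddX p_odd orbT.
have s_gt2 : 2 < s.
  have s_gt1 : 1 < s by rewrite -(exp1n n) ltn_exp2r ?prime_gt1.
  by case: (s) s_odd s_gt1 => [|[|[|]]].
have s_gt1 := ltnW s_gt2.
have cardKs : #|K| = s ^ 2 by rewrite cardK -qE.
have two_neq0 : (2%:R != 0 :> K)%R.
  apply/negP => two0; have : 2 \in [pchar K]%R by rewrite inE /= two0.
  by rewrite (pcharf_eq charK) inE => /eqP p2; rewrite -p2 in p_odd.
have frobD (x y : K) : ((x + y) ^+ s = x ^+ s + y ^+ s)%R.
  by apply: exprDn_pchar; rewrite pnatX pnatE // charK.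
exists (point K : finType), (point K), (@point_incident K s), id, id.
have card_abs := card_absolute_points s_odd s_gt1 cardKs two_neq0 frobD.
have q_gt : 3 * s <= s ^ 2 by rewrite -mulnn leq_mul2r s_gt2 orbT.
rewrite qE; split.
- exact: hughes_plane.
- exact: hughes_polarity.
(* Equality with s^2 + 1 would mean s (s - 1)^2 = 0. *)
- by rewrite /orthogonal_polarity; move: #|_| card_abs => m; nia.
- case=> t [tq]; have -> : t = s by apply/eqP; rewrite -eqn_sqr -tq mulnn.
  (* Equality with s^3 + 1 would mean s^3 = s. *)
  by move: #|_| card_abs => m; nia.
apply: (@leq_trans (2 * #|absolute_points (@point_incident K s) id|)).
  by move: #|_| card_abs => m; nia.
rewrite leq_mul2l /=.
by apply: (leq_bigmax_cond (F := fun S : {set point K} => #|S|));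
  apply: absolute_points_independent.
Qed.
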